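(* Let $\mathbf{A}=(A;\leq,{}',0,1)$ be a De Morgan poset and $G,H$ partial mappings of $A$ into itself which are semi-tense operators on $\mathbf A$ (see context), and suppose $R_G=(R_H)^{-1}$, where $$R_K=\{(s,t)\in T_{\mathbf A}^{\mathrm{DMP}}\times T_{\mathbf A}^{\mathrm{DMP}}\mid \forall x\in\mathrm{dom}(K):\ s(K(x))\leq t(x)\}\quad (K\in\{G,H\}).$$ Then $(T_{\mathbf A}^{\mathrm{DMP}},R_G)$ is a frame with both $R_G$ and $(R_G)^{-1}$ serial. Let $\widehat G,\widehat H$ be the operators on $M_2^{T_{\mathbf A}^{\mathrm{DMP}}}$ given by $\widehat G(p)(s)=\bigwedge_{M_2}\{p(t)\mid s\mathrel{R_G}t\}$ and $\widehat H(p)(s)=\bigwedge_{M_2}\{p(t)\mid t\mathrel{R_G}s\}$ (so that $(\mathbf{M}_2^{T_{\mathbf A}^{\mathrm{DMP}}};\widehat G,\widehat H)$ is a dynamic De Morgan algebra). Then the map $i_{\mathbf A}\colon A\to M_2^{T_{\mathbf A}^{\mathrm{DMP}}}$, $i_{\mathbf A}(a)(s)=s(a)$, is an order-reflecting morphism of De Morgan posets into the complete De Morgan lattice $\mathbf{M}_2^{T_{\mathbf A}^{\mathrm{DMP}}}$ such that $i_{\mathbf A}(G(a))=\widehat G(i_{\mathbf A}(a))$ for all $a\in\mathrm{dom}(G)$ and $i_{\mathbf A}(H(a))=\widehat H(i_{\mathbf A}(a))$ for all $a\in\mathrm{dom}(H)$.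
   Context: A De Morgan poset is a structure $(A;\leq,{}',0,1)$ where $(A;\leq)$ is a poset with least element $0$ and greatest element $1$, and $'$ is a unary operation with $a\leq b\Rightarrow b'\leq a'$ and $a''=a$. A morphism of De Morgan posets preserves order, negation, $0$, $1$; it is order reflecting if $f(a)\leq f(b)$ iff $a\leq b$. For a partial map $K$ on $A$, its dual $K^{\partial}$ is defined at $a$ iff $a'\in\mathrm{dom}(K)$, by $K^{\partial}(a)=K(a')'$; write $F=G^{\partial}$, $P=H^{\partial}$. Partial maps $G,H$ on $A$ are semi-tense operators if: (P1) $G(0)=0$, $G(1)=1$, $H(0)=0$, $H(1)=1$; (P2) $x\leq y$ implies $G(x)\leq G(y)$ whenever both exist, and $H(x)\leq H(y)$ whenever both exist; (P4) $x\leq y$ implies $G(x)\leq F(y)$ whenever $G(y')$ and $G(x)$ exist, and $H(x)\leq P(y)$ whenever $H(y')$ and $H(x)$ exist. A dynamic De Morgan algebra is a De Morgan poset with total maps $G,H$ satisfying (P1), (P2), (P4) and (P3): $x\leq G(P(x))$ and $x\leq H(F(x))$. A frame is a pair $(T,R)$ with $T$ non-empty and $R\subseteq T\times T$; $R$ is serial if every $x$ has some $y$ with $x\mathrel{R}y$. $\mathbf{M}_2$ is the four-element complete De Morgan lattice on $\{0,1\}\times\{0,1\}$ with componentwise order and $(a,b)'=(1-b,1-a)$; $\mathbf{M}_2^T$ is the direct power with componentwise order and negation. For a proper down-set $D$ of $\mathbf A$ (down-set with $0\in D$, $1\notin D$) let $h_D(a)=0$ iff $a\in D$ (else $1$), $h_D^{\partial}(a)=1-h_D(a')$,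 and $\kappa_D(a)=(h_D(a),h_D^{\partial}(a))\in M_2$. $T_{\mathbf A}^{\mathrm{DMP}}$ is the set of all $\kappa_D$, $D$ ranging over proper down-sets of $\mathbf A$.
   Formalization: That T_A^DMP is non-empty (so that (T_A^DMP, R_G) is a frame) is stated only when 0 ≠ 1 in A, since the one-element De Morgan poset has no proper down-set; all other conclusions are stated for every De Morgan poset. *)

(* Defs.v *)
From HB Require Import structures.
From mathcomp Require Import all_boot all_order.
From mathcomp Require Import boolp classical_sets.

Set Implicit Arguments.
Unset Strict Implicit.
Unset Printing Implicit Defensive.

Import Order.Theory.
Local Open Scope order_scope.
Local Open Scope classical_set_scope.

(* The constants 0 and 1 are \bot and \top; they are allowed to coincide. *)
HB.mixin Record isDeMorgan (d : Order.disp_t) A of Order.TBPOrder d A := {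
  dneg : A -> A;
  dneg_anti : forall a b : A, a <= b -> dneg b <= dneg a;
  dnegK : involutive dneg
}.

#[short(type="deMorganPOrderType")]
HB.structure Definition DeMorganPOrder (d : Order.disp_t) :=
  { A of isDeMorgan d A & Order.TBPOrder d A }.

Section Morphisms.
Context {d d' : Order.disp_t}.
Context {A : deMorganPOrderType d} {B : deMorganPOrderType d'}.

Record demorgan_morphism (f : A -> B) : Prop := DemorganMorphism {
  dmm_le : {homo f : a b / a <= b};
  dmm_neg : {morph f : a / dneg a};
  dmm_bot : f \bot = \bot;
  dmm_top : f \top = \top
}.

Definition order_reflecting (f : A -> B) : Prop :=
  forall a b : A, f a <= f b <-> a <= b.

End Morphisms.

Definition complete_lattice (d : Order.disp_t) (L : porderType d) : Prop :=
  forall S : set L, infimums S !=set0 /\ supremums S !=set0.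

Section TenseOperators.
Context {d : Order.disp_t} {A : deMorganPOrderType d}.

(* Partial maps on A are functions A -> option A. *)
Definition pdual (K : A -> option A) : A -> option A :=
  fun a => omap dneg (K (dneg a)).

Record semi_tense (G H : A -> option A) : Prop := SemiTense {
  st_G0 : G \bot = Some \bot;
  st_G1 : G \top = Some \top;
  st_H0 : H \bot = Some \bot;
  st_H1 : H \top = Some \top;
  st_G_le : forall x y gx gy,
    x <= y -> G x = Some gx -> G y = Some gy -> gx <= gy;
  st_H_le : forall x y hx hy,
    x <= y -> H x = Some hx -> H y = Some hy -> hx <= hy;
  st_GF : forall x y gx fy,
    x <= y -> G x = Some gx -> pdual G y = Some fy -> gx <= fy;
  st_HP : forall x y hx py,
    x <= y -> H x = Some hx -> pdual H y = Some py -> hx <= py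
}.

Definition tdual (K : A -> A) : A -> A := fun a => dneg (K (dneg a)).

Record dynamic_demorgan (G H : A -> A) : Prop := DynamicDemorgan {
  dyn_semi_tense : semi_tense (fun x => Some (G x)) (fun x => Some (H x));
  dyn_GP : forall x, x <= G (tdual H x);
  dyn_HF : forall x, x <= H (tdual G x)
}.

End TenseOperators.

(* The relation of a frame is arbitrary; only its carrier is constrained. *)
Definition is_frame (T : Type) (R : set (T * T)) : Prop := [set: T] !=set0.

Definition serial (T : Type) (R : set (T * T)) : Prop :=
  forall x : T, exists y : T, R (x, y).

Definition M2 : Type := (bool *p bool)%type.

HB.instance Definition _ := Order.TBDistrLattice.copy M2 (bool *p bool)%type.

Definition M2neg (u : M2) : M2 := (~~ u.2, ~~ u.1).

Lemma M2neg_anti (u v : M2) : u <= v -> M2neg v <= M2neg u.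
Proof. by case: u v => [[] []] [[] []]. Qed.

Lemma M2negK : involutive M2neg.
Proof. by case=> [] [] []. Qed.

HB.instance Definition _ := isDeMorgan.Build _ M2 M2neg_anti M2negK.

Section Power.
Context (T : Type) {d : Order.disp_t}.

Section Bounded.
Variable B : tbPOrderType d.

Lemma fun_le0x (p : T -> B) : (fun=> \bot : B) <= p.
Proof. by apply/asboolP => s; exact: le0x. Qed.

Lemma fun_lex1 (p : T -> B) : p <= (fun=> \top : B).
Proof. by apply/asboolP => s; exact: lex1. Qed.

HB.instance Definition _ := Order.hasBottom.Build _ (T -> B) fun_le0x.
HB.instance Definition _ := Order.hasTop.Build _ (T -> B) fun_lex1.
End Bounded.

Variable B : deMorganPOrderType d.

Definition fun_neg (p : T -> B) : T -> B := fun s => dneg (p s).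

Lemma fun_neg_anti (p q : T -> B) : p <= q -> fun_neg q <= fun_neg p.
Proof. by move=> /asboolP pq; apply/asboolP => s; exact/dneg_anti/pq. Qed.

Lemma fun_negK : involutive fun_neg.
Proof. by move=> p; apply/funext => s; exact: dnegK. Qed.

HB.instance Definition _ := isDeMorgan.Build _ (T -> B) fun_neg_anti fun_negK.
End Power.

(* infimum x0 S is x0 when S is empty, whence the choice of \top. *)
Definition M2meet (S : set M2) : M2 := infimum (\top : M2) S.

Lemma M2leE (u v : M2) : (u <= v) = (u.1 ==> v.1) && (u.2 ==> v.2).
Proof. by case: u v => [[] []] [[] []]. Qed.

Lemma M2meetP (S : set M2) : infimums S (M2meet S).
Proof.
rewrite /M2meet /infimum; case: eqP => [->|_].
  by split=> [x []|x _]; exact: lex1.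
apply: xgetPex.
exists (`[< forall u, S u -> u.1 >], `[< forall u, S u -> u.2 >]); split.
  move=> u Su; rewrite M2leE /=.
  by apply/andP; split; apply/implyP => /asboolP; apply.
move=> v lbv; rewrite M2leE /=; apply/andP.
split; apply/implyP => hv; apply/asboolP => u /lbv; rewrite M2leE hv => /andP[] //.
Qed.

Section Frame.
Context {T : Type} (R : set (T * T)).

Definition Ghat (p : T -> M2) : T -> M2 :=
  fun s => M2meet [set p t | t in [set t | R (s, t)]].

Definition Hhat (p : T -> M2) : T -> M2 :=
  fun s => M2meet [set p t | t in [set t | R (t, s)]].

End Frame.

Section CanonicalFrame.
Context {d : Order.disp_t} {A : deMorganPOrderType d}.

Record proper_downset (D : set A) : Prop := ProperDownset {
  pd_down : forall a b : A, a <= b -> D b -> D a;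
  pd_bot : D \bot;
  pd_top : ~ D \top
}.

Definition hD (D : set A) (a : A) : bool := ~~ `[< D a >].

Definition hD_dual (D : set A) (a : A) : bool := ~~ hD D (dneg a).

Definition kappa (D : set A) : A -> M2 := fun a => (hD D a, hD_dual D a).

End CanonicalFrame.

Definition TDMP (d : Order.disp_t) (A : deMorganPOrderType d) : set (A -> M2) :=
  [set kappa D | D in [set D | proper_downset D]].

Arguments TDMP {d} A.

Section CanonicalRelation.
Context {d : Order.disp_t} {A : deMorganPOrderType d}.

Definition RK (K : A -> option A) : set (TDMP A * TDMP A) :=
  [set st | forall x y : A, K x = Some y -> val st.1 y <= val st.2 x].

Definition iA (a : A) : TDMP A -> M2 := fun s => val s a.

End CanonicalRelation.

Arguments iA {d} A.

(* Main.v *)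
Require Import Defs.
From HB Require Import structures.
From mathcomp Require Import all_boot all_order.
From mathcomp Require Import boolp classical_sets.

Set Implicit Arguments.
Unset Strict Implicit.
Unset Printing Implicit Defensive.

Import Order.Theory.
Local Open Scope order_scope.
Local Open Scope classical_set_scope.

(** For proper down-sets D and E, the pair (kappa D, kappa E) lies in R_G iff
    L <= E <= U, where L is the down-set generated by the y with F(y) in D and
    U is the set of z such that G(x) is in D for all x <= z in dom(G). Axiom
    (P4) says exactly that L <= U, and (P1) makes both proper. The choice
    E = U realizes the first coordinate of the meet defining G^(i(a)) at
    kappa D, and E = L realizes the second one. *)

Lemma fun_leP (T : Type) (d : Order.disp_t) (B : tbPOrderType d)
  (p q : T -> B) : p <= q <-> forall s, p s <= q s.
Proof. by split=> [/asboolP|pq] //; apply/asboolP. Qed.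

(** The supremum of [S] arises as the infimum of its set of upper bounds. *)
Lemma infimums_complete_lattice (d : Order.disp_t) (L : porderType d) :
  (forall S : set L, infimums S !=set0) -> complete_lattice L.
Proof.
move=> infL S; split; first exact: infL.
have [x [lbx glbx]] := infL (ubound S).
exists x; split=> [y Sy|y uby]; last exact: lbx.
by apply: glbx => z; apply.
Qed.

Lemma M2power_complete (T : Type) : complete_lattice (T -> M2).
Proof.
apply: infimums_complete_lattice => S.
exists (fun s => M2meet [set p s | p in S]); split=> [p Sp|q lbq];
    apply/fun_leP => s; have [lb glb] := M2meetP [set p s | p in S].
  by apply: lb; exists p.
by apply: glb => _ [p Sp <-]; have /fun_leP := lbq _ Sp.
Qed.

(** The axioms treat both operators alike, so what is shown for the first one also covers [H]. *)
Lemma semi_tenseC (d : Order.disp_t) (A : deMorganPOrderType d)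
  (G H : A -> option A) : semi_tense G H -> semi_tense H G.
Proof. by case. Qed.

Section FrameOperators.
Context {T : Type}.
Implicit Types (R : set (T * T)) (p q : T -> M2).

Lemma Ghat_lb R p s t : R (s, t) -> Ghat R p s <= p t.
Proof. by move=> Rst; apply: (M2meetP _).1; exists t. Qed.

Lemma Ghat_glb R p s u : (forall t, R (s, t) -> u <= p t) -> u <= Ghat R p s.
Proof. by move=> le_up; apply: (M2meetP _).2 => _ [t Rst <-]; exact: le_up. Qed.

(** Lets every result on [Ghat] serve for [Hhat] through the converse relation. *)
Lemma HhatE R : Hhat R = Ghat (R^-1)%relation.
Proof. by []. Qed.

Lemma Ghat_le R p q : p <= q -> Ghat R p <= Ghat R q.
Proof.
move=> /fun_leP pq; apply/fun_leP => s; apply: Ghat_glb => t Rst.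
by apply: le_trans (pq t); exact: Ghat_lb.
Qed.

Lemma Ghat_top R : Ghat R \top = \top.
Proof.
apply/le_anti/andP; split; first exact: lex1.
by apply/fun_leP => s; apply: Ghat_glb.
Qed.

(** Seriality excludes the empty meet, whose value would be [\top]. *)
Lemma Ghat_bot R : serial R -> Ghat R \bot = \bot.
Proof.
move=> serR; apply/le_anti/andP; split; last exact: le0x.
by apply/fun_leP => s; have [t Rst] := serR s; exact: (Ghat_lb _ Rst).
Qed.

(** The dual operator is a join over successors. Any successor [t] of [s] links the two sides: the
    meet is below [p t], hence below [q t], which is below the join. *)
Lemma Ghat_le_tdual R p q : serial R -> p <= q -> Ghat R p <= tdual (Ghat R) q.
Proof.
move=> serR /fun_leP pq; apply/fun_leP => s; have [t Rst] := serR s.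
apply: (le_trans (Ghat_lb p Rst)); apply: (le_trans (pq t)).
by rewrite -[q t]dnegK; apply: dneg_anti; exact: (Ghat_lb _ Rst).
Qed.

(** Each [s] is a predecessor of its own successors [t], so [p s] is among the terms joined at
    [t]. *)
Lemma le_Ghat_tdual R p : p <= Ghat R (tdual (Ghat (R^-1)%relation) p).
Proof.
apply/fun_leP => s; apply: Ghat_glb => t Rst.
by rewrite -[p s]dnegK; apply: dneg_anti; exact: Ghat_lb.
Qed.

Lemma dynamic_demorgan_hat R :
  serial R -> serial (R^-1)%relation -> dynamic_demorgan (Ghat R) (Hhat R).
Proof.
move=> serR serRV; rewrite HhatE; split; last 2 first.
- exact: le_Ghat_tdual.
- exact: le_Ghat_tdual.
split; rewrite ?Ghat_top ?Ghat_bot //.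
- by move=> p q _ _ pq [<-] [<-]; exact: Ghat_le.
- by move=> p q _ _ pq [<-] [<-]; exact: Ghat_le.
- by move=> p q _ _ pq [<-] [<-]; exact: Ghat_le_tdual.
- by move=> p q _ _ pq [<-] [<-]; exact: Ghat_le_tdual.
Qed.

End FrameOperators.

Section Canonical.
Context {d : Order.disp_t} {A : deMorganPOrderType d}.
Implicit Types (D E : set A) (K L : A -> option A) (a b : A).

Lemma dneg_top : dneg \top = \bot :> A.
Proof.
by apply/eqP; rewrite -lex0 -[\bot]dnegK; apply: dneg_anti; exact: lex1.
Qed.

Lemma dneg_bot : dneg \bot = \top :> A.
Proof. by rewrite -dneg_top dnegK. Qed.

Definition kappaT D (pD : proper_downset D) : TDMP A :=
  SigSub (mem_set (ex_intro2 _ _ D pD erefl : TDMP A (kappa D))).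

Lemma TDMP_kappa (s : TDMP A) : exists D (pD : proper_downset D), s = kappaT pD.
Proof.
case: s => s sT; have := set_mem sT => -[D pD eD].
by exists D, pD; apply: val_inj; rewrite /= eD.
Qed.

(** The first coordinate of [kappa] is 0 on the down-set, so its implication runs backwards; the
    second is 1 exactly when the negated argument lies in the down-set. *)
Lemma kappa_le D E a b :
  (kappa D a <= kappa E b) <->
  (E b -> D a) /\ (D (dneg a) -> E (dneg b)).
Proof.
rewrite M2leE /= /hD_dual /hD !negbK; split.
  case/andP => /implyP le1 /implyP le2; split => [Eb|Da].
    by apply: contrapT => /asboolPn /le1 /asboolPn; apply.
  by apply/asboolP/le2/asboolP.
case=> le1 le2; apply/andP; split; apply/implyP.
  by move=> /asboolPn nDa; apply/asboolPn => /le1.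
by move=> /asboolP /le2 ?; apply/asboolP.
Qed.

Lemma kappa_dneg D a : kappa D (dneg a) = dneg (kappa D a).
Proof. by rewrite /kappa /hD_dual dnegK /dneg /= /M2neg /= negbK. Qed.

(** Principal down-sets separate points, whence order reflection; the case [b = \bot] provides a
    point of the frame. *)
Lemma proper_principal b : b != \top -> proper_downset [set a | a <= b].
Proof.
move=> b1; split=> /= [a c||]; [exact: le_trans|exact: le0x|].
by rewrite le1x; apply/negP.
Qed.

Lemma iA_morphism : demorgan_morphism (iA A).
Proof.
split=> [a b ab|a||]; last 3 first.
- by apply/funext => s; have [D [pD ->]] := TDMP_kappa s; exact: kappa_dneg.
- apply/funext => s; have [D [pD ->]] := TDMP_kappa s.
  rewrite /iA /= /kappa /hD_dual /hD dneg_bot.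
  by rewrite (asboolT (pd_bot pD)) (asboolF (pd_top pD)).
- apply/funext => s; have [D [pD ->]] := TDMP_kappa s.
  rewrite /iA /= /kappa /hD_dual /hD dneg_top.
  by rewrite (asboolT (pd_bot pD)) (asboolF (pd_top pD)).
apply/fun_leP => s; have [D [pD ->]] := TDMP_kappa s.
by apply/kappa_le; split; apply: (pd_down pD) => //; exact: dneg_anti.
Qed.

Lemma iA_order_reflecting : order_reflecting (iA A).
Proof.
move=> a b; split; last exact: (dmm_le iA_morphism).
(* The principal down-set of [\top] is not proper, so this case is settled directly. *)
have [->|b1] := eqVneq b \top; first by rewrite lex1.
move=> /fun_leP /(_ (kappaT (proper_principal b1))) /kappa_le[+ _].
by apply => /=.
Qed.

Lemma RK_kappa K D E (pD : proper_downset D) (pE : proper_downset E) :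
  RK K (kappaT pD, kappaT pE) <->
  forall x y, K x = Some y -> (E x -> D y) /\ (D (dneg y) -> E (dneg x)).
Proof. by split=> RDE x y Kxy; apply/kappa_le/RDE. Qed.

(** With [u = dneg x], [pdual K u] is [Some (dneg y)]: the generators are the points where the dual
    of [K] has a value in [D]. *)
Definition lower_set K D : set A :=
  [set z | exists x y, [/\ K x = Some y, D (dneg y) & z <= dneg x]].

Definition upper_set K D : set A :=
  [set z | forall x y, K x = Some y -> x <= z -> D y].

Section SemiTense.
Variables (K L : A -> option A) (stK : semi_tense K L).
Variables (D : set A) (pD : proper_downset D).

Lemma lower_sub_upper : lower_set K D `<=` upper_set K D.
Proof.
move=> z [x [y [Kxy Dy zx]]] v w Kvw vz; apply: pd_down Dy => //.
apply: (st_GF stK (le_trans vz zx) Kvw).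
by rewrite /pdual dnegK Kxy.
Qed.

Lemma proper_upper : proper_downset (upper_set K D).
Proof.
split=> [a b ab Ub x y Kxy xa|x y Kxy x0|U1].
- exact: Ub Kxy (le_trans xa ab).
- by apply: pd_down (pd_bot pD) => //; exact: (st_G_le stK x0 Kxy (st_G0 stK)).
- by apply: (pd_top pD); exact: (U1 _ _ (st_G1 stK) (lexx _)).
Qed.

(** [\bot] is the generator [dneg \top] coming from [K \top = \top]; [\top] is excluded because the
    larger [upper_set] already omits it. *)
Lemma proper_lower : proper_downset (lower_set K D).
Proof.
split=> [a b ab [x [y [Kxy Dy bx]]]||/lower_sub_upper].
- by exists x, y; split=> //; exact: le_trans bx.
- exists \top, \top; rewrite (st_G1 stK) dneg_top; split=> //.
  exact: pd_bot pD.
- exact: pd_top proper_upper.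
Qed.

Lemma RK_upper : RK K (kappaT pD, kappaT proper_upper).
Proof.
apply/RK_kappa => x y Kxy; split=> [Ux|Dy]; first exact: Ux Kxy (lexx _).
by apply: lower_sub_upper; exists x, y.
Qed.

Lemma RK_lower : RK K (kappaT pD, kappaT proper_lower).
Proof.
apply/RK_kappa => x y Kxy; split=> [/lower_sub_upper Ux|Dy].
  exact: Ux Kxy (lexx _).
by exists x, y.
Qed.

Lemma upper_mem a b : K a = Some b -> D b -> upper_set K D a.
Proof.
move=> Kab Db x y Kxy xa; apply: pd_down Db => //.
exact: (st_G_le stK xa Kxy Kab).
Qed.

(** Negation turns [dneg a <= dneg x] into [x <= a]; then (P2) gives [y <= b], so [dneg b] lies
    below [dneg y] in [D]. *)
Lemma lower_mem a b : K a = Some b -> lower_set K D (dneg a) -> D (dneg b).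
Proof.
move=> Kab [x [y [Kxy Dy ax]]]; apply: pd_down Dy => //; apply: dneg_anti.
apply: (st_G_le stK _ Kxy Kab).
by rewrite -[x]dnegK -[a]dnegK; exact: dneg_anti.
Qed.

End SemiTense.

Lemma RK_serial K L : semi_tense K L -> serial (RK K).
Proof.
move=> stK s; have [D [pD ->]] := TDMP_kappa s.
by eexists; exact: RK_upper stK _ pD.
Qed.

Lemma iA_Ghat K L a b :
  semi_tense K L -> K a = Some b -> iA A b = Ghat (RK K) (iA A a).
Proof.
move=> stK Kab; apply/le_anti/andP; split; apply/fun_leP => s.
  (* This inequality is the definition of [RK]. *)
  by apply: Ghat_glb => t; apply.
have [D [pD ->]] := TDMP_kappa s.
have := Ghat_lb (iA A a) (RK_lower stK pD).
have := Ghat_lb (iA A a) (RK_upper stK pD).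
(* The order of [M2] is componentwise, so two different successors may bound the two coordinates:
   the upper set the first, the lower set the second. *)
rewrite !M2leE /= => /andP[/implyP leU _] /andP[_ /implyP leL].
apply/andP; split; apply/implyP.
  by move=> /leU /asboolPn nUa; apply/asboolPn => /(upper_mem stK pD Kab).
move=> /leL; rewrite /hD_dual /hD !negbK => /asboolP La.
by apply/asboolP; exact: (lower_mem stK pD Kab La).
Qed.

End Canonical.

Theorem mainTheorem3 (d : Order.disp_t) (A : deMorganPOrderType d)
    (G H : A -> option A) :
  semi_tense G H ->
  RK G = ((RK H)^-1)%relation ->
  [/\ (\bot <> \top :> A -> is_frame (RK G)),
      serial (RK G) /\ serial ((RK G)^-1)%relation,
      complete_lattice (TDMP A -> M2) /\
        dynamic_demorgan (Ghat (RK G)) (Hhat (RK G)),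
      demorgan_morphism (iA A) /\ order_reflecting (iA A)
    & (forall a b : A, G a = Some b -> iA A b = Ghat (RK G) (iA A a)) /\
      (forall a b : A, H a = Some b -> iA A b = Hhat (RK G) (iA A a))].
Proof.
move=> stG RGH; have stH := semi_tenseC stG.
(* This turns [Hhat (RK G)] into [Ghat (RK H)], to which the lemmas on a single operator apply. *)
have RHG : ((RK G)^-1)%relation = RK H by rewrite RGH; apply/seteqP; split=> -[].
have serG := RK_serial stG; have serH := RK_serial stH.
split.
- by move=> /eqP ne01; exists (kappaT (proper_principal ne01)).
- by rewrite RHG.
- split; first exact: M2power_complete.
  by apply: dynamic_demorgan_hat => //; rewrite RHG.
- by split; [exact: iA_morphism|exact: iA_order_reflecting].
- split=> a b Kab; first exact: iA_Ghat stG Kab.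
  by rewrite HhatE RHG; exact: iA_Ghat stH Kab.
Qed.
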